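(* For all $r>0$, $R>0$, $\sigma>0$ there is a constant $c(r,R,\sigma)>0$, depending only on $r,R,\sigma$, such that the following holds. Let $D\subset\mathbb{R}^2$ be a planar convex body contained in a disc of radius $R$. Let $\boldsymbol{x}\in D\setminus\partial D$ and let $\boldsymbol{u}\in\mathbb{R}^2$ be a unit vector such that for some $t_0<0$ one has $rB^2+\boldsymbol{x}+t_0\boldsymbol{u}\subset D$. Let $\boldsymbol{v}$ be one of the two unit vectors orthogonal to $\boldsymbol{u}$, and put $$\delta:=\max\{t:\boldsymbol{x}+t\boldsymbol{u}\in D\},\qquad l_i:=\max\{t:\boldsymbol{x}+(-1)^i t\boldsymbol{v}\in D\},\quad i=1,2.$$ Let $n$ be a positive integer. If $\delta\ge\sigma n^{-2}$, then $$\lambda_n(D,\boldsymbol{x})\le c(r,R,\sigma)\, n^{-2}\sqrt{\min\{l_1l_2,\delta\}}.$$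
   Context: A convex body is a convex compact set with non-empty interior; $\partial D$ is the boundary of $D$; $B^2=\{\boldsymbol{y}\in\mathbb{R}^2:|\boldsymbol{y}|\le1\}$ is the closed Euclidean unit disc. Let $\mathcal{P}_{n,d}$ be the space of all real algebraic polynomials of total degree $\le n$ in $d$ variables. For a compact set $D\subset\mathbb{R}^d$ with non-empty interior, the Christoffel function (with uniform weight) is $\lambda_n(D,\boldsymbol{x})=\left(\sum_{k=1}^N\varphi_k(\boldsymbol{x})^2\right)^{-1}$, $\boldsymbol{x}\in D$, where $\{\varphi_k\}_{k=1}^N$ is an orthonormal basis of $\mathcal{P}_{n,d}$ with respect to $\langle f,g\rangle=\int_D f(\boldsymbol{y})g(\boldsymbol{y})\,d\boldsymbol{y}$. Equivalently, $\lambda_n(D,\boldsymbol{x})=\min\{\int_D f^2(\boldsymbol{y})\,d\boldsymbol{y}: f\in\mathcal{P}_{n,d},\ |f(\boldsymbol{x})|=1\}$. *)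

(* Defs.v *)
From HB Require Import structures.
From mathcomp Require Import all_boot all_order all_algebra.
From mathcomp Require Import all_classical all_reals all_analysis.
(* The notations of mpoly clash with those of mathcomp-analysis. *)
From mathcomp.multinomials Require Import -(notations) mpoly.

Set Implicit Arguments.
Unset Strict Implicit.
Unset Printing Implicit Defensive.

Import Order.TTheory GRing.Theory Num.Theory.
Import numFieldNormedType.Exports.

Local Open Scope classical_set_scope.
Local Open Scope ring_scope.

(* The norm that the library puts on the plane [K * K] is the sup norm, hence
   the separate Euclidean norm; both induce the product topology. *)

Definition dotp (K : realType) (y z : K * K) : K := y.1 * z.1 + y.2 * z.2.

Definition enorm (K : realType) (y : K * K) : K := Num.sqrt (dotp y y).

Definition disc (K : realType) (a : K * K) (rho : K) : set (K * K) :=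
  [set y | enorm (y - a) <= rho].

Definition convex_body (K : realType) (D : set (K * K)) : Prop :=
  [/\ convex_set D, compact D & D° !=set0].

Definition boundary (T : topologicalType) (A : set T) : set T :=
  closure A `\` A°.

Definition is_max (K : realType) (A : set K) (m : K) : Prop :=
  A m /\ ubound A m.

Definition peval (K : realType) (p : mpoly 2 K) (y : K * K) : K :=
  meval (fun i : 'I_2 => if i == ord0 then y.1 else y.2) p.

(* [msize p] is the total degree plus one, and [msize 0 = 0]. *)
Definition in_Pn (K : realType) (n : nat) (p : mpoly 2 K) : bool :=
  (msize p <= n.+1)%N.

Definition inner (K : realType) (D : set (K * K)) (p q : mpoly 2 K) : K :=
  \int[(lebesgue_measure \x lebesgue_measure)%E]_(y in D)
    (peval p y * peval q y).

Definition orthonormal_basis (K : realType) (n : nat) (D : set (K * K))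
    (N : nat) (phi : 'I_N -> mpoly 2 K) : Prop :=
  [/\ forall k, in_Pn n (phi k),
      forall j k, inner D (phi j) (phi k) = (j == k)%:R
    & forall p, in_Pn n p -> exists a : 'I_N -> K, p = \sum_k a k *: phi k].

(* The value at [x] of the Christoffel function computed from an orthonormal
   basis [phi]; it does not depend on the choice of [phi]. *)
Definition christoffel (K : realType) (N : nat) (phi : 'I_N -> mpoly 2 K)
    (x : K * K) : K :=
  (\sum_k peval (phi k) x ^+ 2)^-1.

(* Main.v *)
(* An upper bound for the Christoffel function at x only needs one polynomial f
   of degree at most n with f(x) >= 1 and a small integral of f^2 over D.  Take
   f = P1(a) P2(b), where a and b are affine with values in [0, 1] on D: then
   the integral is at most the product of those of P1^2 and P2^2 over [0, 1],
   divided by the Jacobian determinant of (a, b).  The univariate factors come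
   from sin(N phi) / (N sin phi), which is a polynomial in z = sin phi for odd
   N, is 1 at z = 0 and is O(1 / (N |z|)); squaring it and moving the peak to s0
   in the variable s with t = s^2 yields P with P(d) >= 1 and integral of P^2
   of order sqrt(d) / n at d = s0^2.

   The affine functions come from lines separating D from points just outside
   it.  A line near x + delta u gives the bound by sqrt(delta).  A line near the
   end of the chord of direction v gives the bound by sqrt(l1 l2) when the other
   half of the chord is long.  When the chord is short, lines near both its ends
   do: with p, q > 0 the components of their normals along v, the distances from
   x are at most 2 l1 p and 2 l2 q, and the disc behind x forces the Jacobian to
   be at least a constant times p + q >= 2 sqrt(p q). *)

Require Import Defs.
From mathcomp Require Import all_boot all_order all_algebra.
From mathcomp Require Import all_classical all_reals all_analysis.
From mathcomp Require Import measurable_realfun.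
From mathcomp.multinomials Require Import -(notations) mpoly.
From mathcomp Require Import ring lra zify.

Import Order.TTheory GRing.Theory Num.Theory.
Import numFieldNormedType.Exports.

Local Open Scope classical_set_scope.
Local Open Scope ring_scope.

(** * Univariate peaking polynomials from Chebyshev polynomials *)

Lemma normr_sin_mulrn (K : realType) (n : nat) (phi : K) :
  `|sin (n%:R * phi)| <= n%:R * `|sin phi|.
Proof.
elim: n => [|n IHn]; first by rewrite !mul0r sin0 normr0.
rewrite -(addn1 n) natrD !mulrDl !mul1r sinD (le_trans (ler_normD _ _))//.
rewrite lerD//.
  rewrite normrM (le_trans _ IHn)// ler_piMr//.
  by rewrite ler_norml cos_geN1 cos_le1.
rewrite normrM ler_piMl// ler_norml.
by rewrite cos_geN1 cos_le1.
Qed.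

(** Induction from N to N + 2 by the addition formulas for N phi and 2 phi; these mix sine and
    cosine, so both claims are carried together. The factor sin phi splits off because N is odd, and
    what remains takes the value N at 0, which later normalises the peak. *)
Lemma sin_cos_odd_multiple (K : realType) (k : nat) :
  exists p q : {poly K},
    [/\ [/\ (size p <= k.+1)%N, (size q <= k.+1)%N, p.[0] = (k.*2.+1)%:R
          & q.[0] = 1],
        forall phi, sin ((k.*2.+1)%:R * phi) = sin phi * p.[sin phi ^+ 2]
      & forall phi, cos ((k.*2.+1)%:R * phi) = cos phi * q.[sin phi ^+ 2]].
Proof.
elim: k => [|k [p [q [[sp sq p0 q0] Hp Hq]]]].
  exists 1, 1; split=> [|phi|phi]; last 2 first.
  - by rewrite mul1r hornerC mulr1.
  - by rewrite mul1r hornerC mulr1.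
  by split; rewrite ?size_poly1 ?hornerC.
have size_step (c : K) (f : {poly K}) : (size f <= k.+1)%N ->
    (size (f * (c%:P - 2%:P * 'X) : {poly K})%R <= k.+2)%N.
  move=> sf; rewrite (leq_trans (size_polyMleq _ _))//.
  have: (size (c%:P - 2%:P * 'X : {poly K})%R <= 2)%N.
    rewrite (leq_trans (size_polyD _ _))// geq_max size_polyN.
    rewrite (leq_trans (size_polyC_leq1 _))//= mul_polyC.
    by rewrite (leq_trans (size_scale_leq _ _))// size_polyX.
  by move: sf; case: (size f) => [|m] /=; lia.
exists (p * (1%:P - 2%:P * 'X) + q * (2%:P - 2%:P * 'X)).
exists (q * (1%:P - 2%:P * 'X) + p * (0%:P - 2%:P * 'X)).
have step phi : (k.+1.*2.+1)%:R * phi = (k.*2.+1)%:R * phi + (phi + phi) :> K.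
  by rewrite doubleS -!natr1; ring.
split=> [|phi|phi]; last 2 first.
- rewrite step sinD cosD sinD Hp Hq !(hornerE, hornerM, hornerD, hornerN) /=.
  have := cos2sin2 phi; move: (sin phi) (cos phi) => s c c2.
  move: (p.[_]) (q.[_]) => a b.
  transitivity (s * (a * (c ^+ 2 - s ^+ 2) + 2 * b * c ^+ 2)); first by ring.
  by rewrite c2; ring.
- rewrite step cosD cosD sinD Hp Hq !(hornerE, hornerM, hornerD, hornerN) /=.
  have := cos2sin2 phi; move: (sin phi) (cos phi) => s c c2.
  move: (p.[_]) (q.[_]) => a b.
  transitivity (c * (b * (c ^+ 2 - s ^+ 2) - 2 * a * s ^+ 2)); first by ring.
  by rewrite c2; ring.
split.
- by rewrite (leq_trans (size_polyD _ _))// geq_max !size_step.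
- by rewrite (leq_trans (size_polyD _ _))// geq_max !size_step.
- rewrite !(hornerE, hornerM, hornerD, hornerN) /= p0 q0 doubleS -!natr1; ring.
- rewrite !(hornerE, hornerM, hornerD, hornerN) /= p0 q0; ring.
Qed.

(* The witness is [(sin (N phi) / (N sin phi)) ^ 2] with [z = sin phi], the
   square of [T_N(z) / (N z)] for the Chebyshev polynomial of odd degree N. *)
Lemma peak_poly (K : realType) (k : nat) :
  exists j : {poly K}, [/\ (size j <= (4 * k).+1)%N, j.[0] = 1 &
    forall z, -1 <= z <= 1 ->
      0 <= j.[z] /\ j.[z] * (1 + ((k.*2.+1)%:R * z) ^+ 2) <= 2].
Proof.
have [p [_ [[sp _ p0 _] Hp _]]] := sin_cos_odd_multiple K k.
set N : K := (k.*2.+1)%:R in p0 Hp *.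
have N0 : 0 < N by rewrite ltr0n.
exists ((N^-1 *: (p \Po 'X^2)) ^+ 2); split.
- have s2 : (size (N^-1 *: (p \Po 'X^2))%R <= (2 * k).+1)%N.
    rewrite (leq_trans (size_scale_leq _ _))//.
    rewrite (leq_trans (size_comp_poly_leq _ _))// size_polyXn/=.
    by move: sp; case: (size p) => [|m] /=; lia.
  rewrite (leq_trans (size_poly_exp_leq _ _))//=.
  by move: s2; case: (size _) => [|m] /=; lia.
- rewrite horner_exp hornerZ horner_comp hornerXn expr0n p0 mulVf ?gt_eqF//.
  by rewrite expr1n.
move=> z z1; rewrite horner_exp hornerZ horner_comp hornerXn.
set a := N^-1 * _.
have z1' : z \in `[-1, 1] by rewrite in_itv.
have aE : a * (N * z) = sin (N * asin z).
  by rewrite Hp asinK// /a; field; rewrite gt_eqF.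
(* The claim is the sum of two bounds by 1: [b1] comes from |sin| <= 1, and [a1] from |sin (N phi)|
   <= N |sin phi|. The latter is divided by |sin phi|, so z = 0 is treated apart. *)
have b1 : (a * (N * z)) ^+ 2 <= 1.
  by rewrite aE -real_normK ?num_real// expr_le1// ler_norml sin_geN1 sin_le1.
have a1 : a ^+ 2 <= 1.
  have [z0|zneq0] := eqVneq z 0.
    by rewrite /a z0 expr0n p0 mulVf ?gt_eqF// expr1n.
  have := normr_sin_mulrn K (k.*2.+1) (asin z); rewrite -/N asinK// -aE !normrM.
  rewrite (ger0_norm (ltW N0)) ger_pMl ?mulr_gt0 ?normr_gt0// => a1.
  by rewrite -real_normK ?num_real// expr_le1// /a normrM.
split; first exact: sqr_ge0.
rewrite mulrDr mulr1 -exprMn; lra.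
Qed.

(* The reflected peak [J(- s)] makes [J(s) + J(- s)] a polynomial in [s ^ 2] and
   obeys the same bound, as [|- s - s0| >= |s - s0|] for nonnegative s, s0. *)
Lemma one_sided_peak_poly (K : realType) (k : nat) (s0 : K) :
  0 <= s0 <= 1 ->
  exists P : {poly K}, [/\ (size P <= k.*2.+1)%N, 1 <= P.[s0 ^+ 2] &
    forall s, 0 <= s <= 1 -> 0 <= P.[s ^+ 2] /\
      P.[s ^+ 2] * (1 + ((k.*2.+1)%:R * ((s - s0) / 2)) ^+ 2) <= 4].
Proof.
move=> s01; have [j [sj j0 Hj]] := peak_poly K k.
set N : K := (k.*2.+1)%:R in Hj *.
(* Halving keeps (s - s0) / 2 in [-1, 1], where [j] is controlled, for every s in [-1, 1]; both s
   and - s are going to be used. *)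
pose J := j \Po (2^-1 *: ('X - s0%:P)).
have JE s : J.[s] = j.[(s - s0) / 2].
  by rewrite horner_comp hornerZ !hornerE mulrC.
have PE s : (2 *: even_poly J).[s ^+ 2] = J.[s] + J.[- s].
  rewrite -[in J.[s]](poly_even_odd J) -[in J.[- s]](poly_even_odd J).
  by rewrite !(hornerE, horner_comp, hornerXn) sqrrN /=; ring.
have Jle s : -1 <= s <= 1 ->
    0 <= J.[s] /\ J.[s] * (1 + (N * ((s - s0) / 2)) ^+ 2) <= 2.
  by move=> s1; rewrite JE; apply: Hj; lra.
exists (2 *: even_poly J); split.
- rewrite (leq_trans (size_scale_leq _ _))// (leq_trans (size_even_poly _))//.
  have sJ : (size J <= (4 * k).+1)%N.
    rewrite (leq_trans (size_comp_poly_leq _ _))//.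
    have : (size (2^-1 *: ('X - s0%:P))%R <= 2)%N.
      by rewrite (leq_trans (size_scale_leq _ _))// size_XsubC.
    move: sj; case: (size j) => [|m]; case: (size _) => [|[|[|u]]] //=; lia.
  have -> : (k.*2.+1)%N = uphalf (4 * k).+1 by lia.
  exact: uphalf_leq.
(* At s0 the peak contributes J(s0) = j(0) = 1 and its reflection something nonnegative. *)
- rewrite PE; have [|+ _] := Jle (- s0); first lra.
  by rewrite (JE s0) subrr mul0r j0; lra.
move=> s sle; rewrite PE.
have [|p1 p2] := Jle s; first lra.
have [|q1 q2] := Jle (- s); first lra.
split; first lra.
rewrite mulrDl.
have : J.[- s] * (1 + (N * ((s - s0) / 2)) ^+ 2) <=
    J.[- s] * (1 + (N * ((- s - s0) / 2)) ^+ 2).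
  rewrite ler_wpM2l// lerD2l !exprMn ler_wpM2l ?sqr_ge0// ler_wpM2r ?sqr_ge0//.
  rewrite -subr_ge0 (_ : _ - _ = 4 * (s * s0)); last by ring.
  by case/andP: sle s01 => s_ge0 _ /andP[s0_ge0 _]; rewrite !mulr_ge0.
lra.
Qed.

(** * The integral of the squared peak and the resulting univariate bound *)

Lemma deriv_poly_surj (K : realType) (p : {poly K}) :
  exists q : {poly K}, q^`() = p.
Proof.
exists (\poly_(i < (size p).+1) (p`_i.-1 / i%:R)).
apply/polyP => i; rewrite coef_deriv coef_poly.
case: ltnP => // sp; last by rewrite mul0rn nth_default.
by rewrite -[LHS]mulr_natr divfK// pnatr_eq0.
Qed.

Lemma integral_horner_itv01 (K : realType) (q : {poly K}) :
  (\int[lebesgue_measure]_(t in `[0%R, 1%R]) (q^`().[t])%:E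
    = (q.[1] - q.[0])%:E)%E.
Proof.
rewrite (@continuous_FTC2 _ _ (horner q))// ?EFinB//.
- by apply: continuous_subspaceT => x; exact: continuous_horner.
- split=> [x _||]; first exact: derivable_horner.
  + exact/cvg_at_right_filter/continuous_horner.
  + exact/cvg_at_left_filter/continuous_horner.
- by move=> x _; rewrite -derivE.
Qed.

(* In the variable [s], [t = s ^ 2], the integrand [2 s P(s ^ 2) ^ 2] is
   dominated by the derivative of [G]. *)
Lemma integral_sqr_peak_le (K : realType) (P : {poly K}) (N s0 : K) :
  0 < N -> 0 <= s0 <= 1 ->
  (forall s, 0 <= s <= 1 -> 0 <= P.[s ^+ 2] /\
     P.[s ^+ 2] * (1 + (N * ((s - s0) / 2)) ^+ 2) <= 4) ->
  (\int[lebesgue_measure]_(t in `[0%R, 1%R]) (P.[t] ^+ 2)%:E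
    <= (64 * (N ^- 2 + pi * (s0 / N)))%:E)%E.
Proof.
move=> N0 s01 HP.
have [Q QE] := deriv_poly_surj K (P ^+ 2).
under eq_integral do rewrite -horner_exp -QE.
rewrite integral_horner_itv01 lee_fin.
pose X (s : K) := N * ((s - s0) / 2).
(* Write s = (s - s0) + s0 in 2 s / (1 + X^2)^2. The first part has an exact antiderivative; in the
   second one factor 1 + X^2 is dropped, which leaves an arctangent. *)
pose G (s : K) := - (4 / N ^+ 2) * (1 + X s ^+ 2)^-1 + 4 * s0 / N * atan (X s).
have X1 s : 0 < 1 + X s ^+ 2 by rewrite ltr_pwDl// sqr_ge0.
pose H (s : K) := Q.[s ^+ 2] - 16 * G s.
have dX (s : K) : is_derive s 1 X (N / 2).
  rewrite /X; apply: is_derive_eq; rewrite !scaler0 ?addr0 ?add0r ?subr0.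
  by rewrite /GRing.scale/= ; ring.
have dG (s : K) : is_derive s 1 G
    ((2 * (s - s0) + 2 * s0 * (1 + X s ^+ 2)) / (1 + X s ^+ 2) ^+ 2).
  rewrite /G.
  have X0 : 1 + X s ^+ 2 != 0 by rewrite gt_eqF.
  have dXi : is_derive s 1 (fun s => (1 + X s ^+ 2)^-1)
      (- (1 + X s ^+ 2) ^- 2 *: (2 * X s * (N / 2))).
    have dX2 : is_derive s 1 (fun s => 1 + X s ^+ 2) (2 * X s * (N / 2)).
      apply: is_derive_eq; rewrite /GRing.scale/=; ring.
    exact: is_deriveV.
  have dA : is_derive s 1 (atan \o X) ((1 + X s ^+ 2)^-1 * (N / 2)).
    exact: is_derive1_comp.
  apply: is_derive_eq; rewrite /GRing.scale/=.
  rewrite /X; field.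
  by rewrite (gt_eqF N0) andbT gt_eqF// ltr_pwDl// sqr_ge0.
have dH (s : K) : is_derive s 1 H
    (2 * s * P.[s ^+ 2] ^+ 2 -
     16 * ((2 * (s - s0) + 2 * s0 * (1 + X s ^+ 2)) / (1 + X s ^+ 2) ^+ 2)).
  have dQ : is_derive s 1 (horner Q \o (fun s => s ^+ 2))
      (P.[s ^+ 2] ^+ 2 * (2 * s)).
    rewrite -horner_exp -QE.
    have ds2 : is_derive s (1:K) (fun s : K => s ^+ 2) (2 * s).
      apply: is_derive_eq; rewrite /GRing.scale/=; ring.
    exact: is_derive1_comp.
  apply: is_derive_eq; rewrite /GRing.scale/=; ring.
have : H 1 <= H 0.
  apply: (@ler0_derive1_le_cc _ H 0 1) => //.
  - move=> s /[!in_itv]/= s1.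
    rewrite derive1E derive_val.
    have [|p0 p1] := HP s; first lra.
    rewrite subr_le0 -/(X s) in p1 *.
    have : P.[s ^+ 2] ^+ 2 <= (4 / (1 + X s ^+ 2)) ^+ 2.
      by rewrite ler_sqr ?nnegrE ?divr_ge0 ?(ltW (X1 s))// ler_pdivlMr.
    rewrite expr_div_n.
    move=> P2; rewrite (le_trans
      (y := 2 * s * (4 ^+ 2 / (1 + X s ^+ 2) ^+ 2)))//.
      by rewrite ler_wpM2l//; lra.
    rewrite !mulrA ler_wpM2r ?invr_ge0 ?sqr_ge0//.
    (* The slack is exactly what dropping that factor costs. *)
    rewrite -subr_ge0 (_ : _ - _ = 32 * s0 * X s ^+ 2); last by ring.
    by rewrite mulr_ge0 ?sqr_ge0// mulr_ge0//; lra.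
  - apply: derivable_within_continuous => s _.
    exact: ex_derive.
  - by rewrite in_itv/= lexx ler01.
  - by rewrite in_itv/= lexx ler01.
rewrite /H expr1n expr0n/=.
have Npos : 0 <= 4 / N ^+ 2 by rewrite divr_ge0 ?sqr_ge0.
have sNpos : 0 <= 4 * s0 / N.
  by rewrite divr_ge0 ?(ltW N0)// mulr_ge0//; lra.
have G0 : - (4 / N ^+ 2) - 4 * s0 / N * (pi / 2) <= G 0.
  rewrite lerD//.
    by rewrite mulNr lerN2 ler_piMr// invf_le1// lerDl sqr_ge0.
  by rewrite -mulrN ler_wpM2l// ltW// atan_gtNpi2.
have G1 : G 1 <= 4 * s0 / N * (pi / 2).
  rewrite (le_trans (y := 0 + 4 * s0 / N * atan (X 1)))//.
    by rewrite lerD2r mulNr oppr_le0 divr_ge0 ?(ltW (X1 _)).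
  by rewrite add0r ler_wpM2l// ltW// atan_ltpi2.
rewrite (_ : 64 * _ =
  16 * (4 / N ^+ 2 + 4 * s0 / N * (pi / 2) * 2)); last first.
  by field; rewrite gt_eqF.
move: (4 / N ^+ 2) (4 * s0 / N * (pi / 2)) G0 G1 => a b.
lra.
Qed.

(** The integral of the squared peak is of order N^-2 + sqrt(d) / N with N of order n. The lower
    bound on d makes 1 / n at most sqrt(d / kappa), so the first term is absorbed by the second. *)
Lemma univariate_christoffel_le (K : realType) (kappa : K) : 0 < kappa ->
  exists C : K, 0 < C /\ forall (n : nat) (d : K),
    (0 < n)%N -> kappa * n%:R ^- 2 <= d -> d <= 1 ->
    exists P : {poly K}, [/\ (size P <= n./2.+1)%N, 1 <= P.[d] &
      (\int[lebesgue_measure]_(t in `[0%R, 1%R]) (P.[t] ^+ 2)%:E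
        <= (C * (Num.sqrt d / n%:R))%:E)%E].
Proof.
move=> kappa0; exists (64 * (9 / Num.sqrt kappa + 3 * pi)); split.
  by rewrite mulr_gt0// addr_gt0 ?divr_gt0 ?sqrtr_gt0// mulr_gt0// pi_gt0.
move=> n d n0 hd d1.
have n0' : (0 : K) < n%:R by rewrite ltr0n.
have d0 : 0 < d by rewrite (lt_le_trans _ hd)// divr_gt0// exprn_gt0.
have s01 : 0 <= Num.sqrt d <= 1.
  by rewrite sqrtr_ge0 -sqrtr1 ler_wsqrtr.
(* The degree 2k is then at most n / 2, so that a product of two such factors has degree at most n,
   while N = 2k + 1 is still at least n / 3. *)
pose k := (n %/ 4)%N.
have [P [sP P1 HP]] := one_sided_peak_poly K k (Num.sqrt d) s01.
have N0 : (0 : K) < k.*2.+1%:R by rewrite ltr0n.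
exists P; split.
- by rewrite (leq_trans sP)// /k; lia.
- by rewrite -(sqr_sqrtr (ltW d0)).
apply: (le_trans (integral_sqr_peak_le K P (k.*2.+1)%:R _ N0 s01 HP)).
rewrite lee_fin -mulrA ler_wpM2l//.
have N3 : (k.*2.+1)%:R^-1 <= 3 / n%:R :> K.
  rewrite ler_pdivlMr// mulrC ler_pdivrMr// -natrM ler_nat /k; lia.
have sd : Num.sqrt kappa / n%:R <= Num.sqrt d.
  rewrite -[X in _ / X]gtr0_norm// -sqrtr_sqr -sqrtrV ?sqr_ge0//.
  by rewrite -sqrtrM ?(ltW kappa0)// ler_wsqrtr.
have sk : 0 < Num.sqrt kappa by rewrite sqrtr_gt0.
rewrite [leRHS]mulrDl lerD//.
  rewrite (le_trans (y := (3 / n%:R) ^+ 2))//.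
    by rewrite -exprVn ler_sqr ?nnegrE ?invr_ge0 ?divr_ge0.
  rewrite (_ : 9 / _ * _ =
      (3 / n%:R) ^+ 2 * (Num.sqrt d / (Num.sqrt kappa / n%:R))).
    by rewrite ler_peMr ?sqr_ge0// ler_pdivlMr ?divr_gt0// mul1r.
  by field; rewrite !gt_eqF.
rewrite [_ * pi]mulrC -!mulrA ler_wpM2l ?pi_ge0// mulrCA ler_wpM2l ?sqrtr_ge0//.
Qed.

(** * Affine changes of variables in Lebesgue integrals *)

Lemma measurable_affine (K : realType) (a b : K) :
  measurable_fun setT
    ((fun x => a * x + b) : measurableTypeR K -> measurableTypeR K).
Proof. by apply: measurable_funD => //; exact: measurable_funM. Qed.

Lemma lebesgue_measure_affine_preimage (K : realType) (a b u v : K) :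
  a != 0 ->
  (lebesgue_measure ((fun x : K => a * x + b)%R @^-1` `]u, v]%classic)
    = (`|a|^-1)%R%:E * lebesgue_measure `]u, v]%classic)%E.
Proof.
move=> a0; have [lt_a0|gt_a0|/eqP] := ltgtP a 0; last by rewrite (negbTE a0).
- rewrite (_ : _ @^-1` _ = `[(v - b) / a, (u - b) / a[%classic).
    rewrite !lebesgue_measure_itv/= !lte_fin ltr_nM2r ?invr_lt0// ltrD2r.
    case: ifPn => _; last by rewrite mule0.
    rewrite -!EFinB -EFinM ltr0_norm//; congr EFin; field.
    by rewrite lt_eqF.
  apply/seteqP; split=> x /=; rewrite !in_itv/= ler_ndivrMr// ltr_ndivlMr//.
    by move=> /andP[ux xv]; apply/andP; split; lra.
  by move=> /andP[ux xv]; apply/andP; split; lra.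
- rewrite (_ : _ @^-1` _ = `](u - b) / a, (v - b) / a]%classic).
    rewrite !lebesgue_measure_itv/= !lte_fin ltr_pM2r ?invr_gt0// ltrD2r.
    case: ifPn => _; last by rewrite mule0.
    rewrite -!EFinB -EFinM gtr0_norm//; congr EFin; field.
    by rewrite gt_eqF.
  apply/seteqP; split=> x /=; rewrite !in_itv/= ltr_pdivrMr// ler_pdivlMr//.
    by move=> /andP[ux xv]; apply/andP; split; lra.
  by move=> /andP[ux xv]; apply/andP; split; lra.
Qed.

(** The pushforward multiplied by |a| agrees with Lebesgue measure on half-open intervals, hence
    everywhere by uniqueness. *)
Lemma pushforward_lebesgue_affine (K : realType) (a b : K) (A : set K) :
  a != 0 -> measurable A ->
  (pushforward lebesgue_measure
    ((fun x => a * x + b)%R : measurableTypeR K -> measurableTypeR K) A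
    = (`|a|^-1)%R%:E * lebesgue_measure A)%E.
Proof.
move=> a0 mA.
have a0' : 0 < `|a| by rewrite normr_gt0.
pose f : measurableTypeR K -> measurableTypeR K := fun x => a * x + b.
have mf : measurable_fun setT f := measurable_affine K a b.
pose nu := mscale (NngNum (ltW a0')) (pushforward lebesgue_measure f).
suff -> : lebesgue_measure A = nu mf A.
  by rewrite /nu/= /mscale/= muleA -EFinM mulVf ?gt_eqF// mul1e.
apply: lebesgue_measure_unique => //= _ [[u v]] _ <-.
rewrite /mscale/= /pushforward lebesgue_measure_affine_preimage//.
by rewrite muleA -EFinM mulfV ?gt_eqF// mul1e.
Qed.

Lemma ge0_integral_affine (K : realType) (a b : K) (h : K -> \bar K) :
  a != 0 -> measurable_fun setT h -> (forall x, (0 <= h x)%E) ->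
  (\int[lebesgue_measure]_x h (a * x + b)%R
    = (`|a|^-1)%R%:E * \int[lebesgue_measure]_x h x)%E.
Proof.
move=> a0 mh h0.
pose f : measurableTypeR K -> measurableTypeR K := fun x => a * x + b.
have mf : measurable_fun setT f := measurable_affine K a b.
have ia : 0 <= `|a|^-1 by rewrite invr_ge0.
transitivity (\int[pushforward lebesgue_measure f]_x h x)%E.
  by rewrite ge0_integral_pushforward.
rewrite (eq_measure_integral (mscale (NngNum ia) (@lebesgue_measure K))).
  by rewrite ge0_integral_mscale.
by move=> A mA _; rewrite /= pushforward_lebesgue_affine.
Qed.

Lemma measurable_affine2 (K : realType) (a b c : K) :
  measurable_fun setT (fun y : measurableTypeR K * measurableTypeR K =>
    a * y.1 + b * y.2 + c).
Proof.
apply: measurable_funD => //; apply: measurable_funD.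
  by apply: measurable_funM => //; exact: measurable_fst.
by apply: measurable_funM => //; exact: measurable_snd.
Qed.

(** Tonelli twice: for fixed x the first form is the new variable s, which costs 1 / |b1|; after
    exchanging the integrals the second form is substituted in x. *)
Lemma ge0_integral_affine2_neq0 (K : realType) (a1 b1 c1 a2 b2 c2 : K)
    (h1 h2 : K -> \bar K) :
  b1 != 0 -> a1 * b2 - a2 * b1 != 0 ->
  measurable_fun setT h1 -> (forall t, (0 <= h1 t)%E) ->
  measurable_fun setT h2 -> (forall t, (0 <= h2 t)%E) ->
  (\int[(lebesgue_measure \x lebesgue_measure)%E]_y
      (h1 (a1 * y.1 + b1 * y.2 + c1)%R * h2 (a2 * y.1 + b2 * y.2 + c2)%R)
    = (`|a1 * b2 - a2 * b1|^-1)%R%:E *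
      (\int[lebesgue_measure]_t h1 t * \int[lebesgue_measure]_t h2 t))%E.
Proof.
move=> b10 J0 mh1 h10 mh2 h20.
have mF : measurable_fun setT (fun y : measurableTypeR K * measurableTypeR K =>
    h1 (a1 * y.1 + b1 * y.2 + c1)%R * h2 (a2 * y.1 + b2 * y.2 + c2)%R)%E.
  by apply: emeasurable_funM; apply: measurableT_comp => //;
    exact: measurable_affine2.
rewrite fubini_tonelli1//; last by move=> y; exact: mule_ge0.
rewrite /fubini_F/=.
(* Eliminating the second coordinate in favour of s turns the second form into c x + d(s); the two
   factors |b1| and |c| multiply to the Jacobian. *)
pose c := - ((a1 * b2 - a2 * b1) / b1).
have c0 : c != 0 by rewrite oppr_eq0 mulf_neq0 ?invr_eq0.
pose d s := b2 * ((s - c1) / b1) + c2.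
transitivity (\int[lebesgue_measure]_x ((`|b1|^-1)%R%:E *
    \int[lebesgue_measure]_s (h1 s * h2 (c * x + d s)%R)))%E.
  apply: eq_integral => x _.
  rewrite -(ge0_integral_affine K b1 (a1 * x + c1)
    (fun s => h1 s * h2 (c * x + d s)%R)%E)//.
  - apply: eq_integral => y _; congr (h1 _ * h2 _)%E; first ring.
    by rewrite /c /d; field.
  - apply: emeasurable_funM => //; apply: measurableT_comp => //.
    rewrite (_ : (fun s => _) =
      (fun s => b2 / b1 * s + (c * x + c2 - b2 * c1 / b1))).
      exact: measurable_affine.
    by apply/funext => s; rewrite /d; field.
  - by move=> s; exact: mule_ge0.
have mG : measurable_fun setT (fun y : measurableTypeR K * measurableTypeR K =>
    h1 y.2 * h2 (c * y.1 + d y.2)%R)%E.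
  apply: emeasurable_funM; apply: measurableT_comp => //.
  rewrite (_ : (fun y => _) = (fun y : measurableTypeR K * measurableTypeR K =>
      c * y.1 + b2 / b1 * y.2 + (c2 - b2 * c1 / b1))).
    exact: measurable_affine2.
  by apply/funext => s; rewrite /d; field.
have G0 (y : measurableTypeR K * measurableTypeR K) :
    (0 <= h1 y.2 * h2 (c * y.1 + d y.2)%R)%E by exact: mule_ge0.
rewrite ge0_integralZl ?lee_fin ?invr_ge0//; last 2 first.
- exact: (measurable_fun_fubini_tonelli_F _ mG G0).
- by move=> x _; apply: integral_ge0 => s _; exact: mule_ge0.
rewrite (fubini_tonelli _ mG G0)/=.
transitivity ((`|b1|^-1)%R%:E * \int[lebesgue_measure]_s
   (h1 s * ((`|c|^-1)%R%:E * \int[lebesgue_measure]_t h2 t)))%E.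
  congr (_ * _)%E; apply: eq_integral => s _.
  rewrite ge0_integralZl//.
  - by rewrite ge0_integral_affine.
  - by apply: measurableT_comp => //; exact: measurable_affine.
rewrite ge0_integralZr//; last first.
  by rewrite mule_ge0 ?lee_fin ?invr_ge0// integral_ge0.
rewrite muleCA [in RHS]muleCA; congr (_ * _)%E.
rewrite muleA -EFinM; congr (_%:E * _)%E.
by rewrite -invfM -normrM /c mulrN normrN mulrC divfK.
Qed.

Lemma ge0_integral_affine2 (K : realType) (a1 b1 c1 a2 b2 c2 : K)
    (h1 h2 : K -> \bar K) :
  a1 * b2 - a2 * b1 != 0 ->
  measurable_fun setT h1 -> (forall t, (0 <= h1 t)%E) ->
  measurable_fun setT h2 -> (forall t, (0 <= h2 t)%E) ->
  (\int[(lebesgue_measure \x lebesgue_measure)%E]_y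
      (h1 (a1 * y.1 + b1 * y.2 + c1)%R * h2 (a2 * y.1 + b2 * y.2 + c2)%R)
    = (`|a1 * b2 - a2 * b1|^-1)%R%:E *
      (\int[lebesgue_measure]_t h1 t * \int[lebesgue_measure]_t h2 t))%E.
Proof.
move=> J0 mh1 h10 mh2 h20.
have [b10|b10] := eqVneq b1 0; last exact: ge0_integral_affine2_neq0.
(* With b1 = 0 the two forms exchange roles, since a nonzero Jacobian forces b2 to be nonzero. *)
under eq_integral do rewrite muleC.
rewrite ge0_integral_affine2_neq0//.
- by rewrite [X in (_ * X)%E]muleC distrC.
- by apply: contra_neq J0 => ->; rewrite b10 !mulr0 subrr.
- by rewrite -oppr_eq0 opprB.
Qed.

(** * Measurability and integrability on compact subsets of the plane *)

Lemma ratr_ball (K : realType) (y e : K) : 0 < e ->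
  exists q : rat, ball (ratr q : K) e y.
Proof.
move=> e0; have /rat_in_itvoo[q] : y - e < y + e.
  by rewrite ltr_wpDr ?ltrBlDr ?ltrDl// ltW.
by rewrite in_itv/= -ltr_distlC => qy; exists q; rewrite -ball_normE/= distrC.
Qed.

(** An open set is the countable union of the squares inside it that have rational centre and radius
    1 / (k + 1). This links the topology of the plane with the product sigma-algebra. *)
Lemma plane_open_measurable (K : realType) (U : set (K * K)) :
  open U -> measurable (U : set (measurableTypeR K * measurableTypeR K)).
Proof.
move=> oU.
pose box (q : rat * rat * nat) : set (K * K) :=
  ball (ratr q.1.1 : K) q.2.+1%:R^-1 `*` ball (ratr q.1.2 : K) q.2.+1%:R^-1.
rewrite (_ : U = \bigcup_q (if `[< box q `<=` U >] then box q else set0)).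
  apply: countable_bigcupT_measurable; first exact: countableP.
  move=> q; case: ifPn => // _; apply: measurableX; exact: measurable_ball.
apply/seteqP; split=> [y Uy|y [q _]]; last first.
  by case: ifPn => // /asboolP; exact.
have /nbhs_ballP[e /= e0 yeU] := open_nbhs_nbhs (conj oU Uy).
have [k _ /(_ _ (leqnn _)) ke] :=
  near_infty_natSinv_lt (PosNum (divr_gt0 e0 (ltr0n K 2))).
have [q1 q1y] : exists q : rat, ball (ratr q : K) k.+1%:R^-1 y.1.
  exact: ratr_ball.
have [q2 q2y] : exists q : rat, ball (ratr q : K) k.+1%:R^-1 y.2.
  exact: ratr_ball.
exists (q1, q2, k) => //; rewrite asboolT//.
move=> z [/= z1 z2]; apply: yeU.
have tri (u v w : K) :
    ball u k.+1%:R^-1 v -> ball u k.+1%:R^-1 w -> ball v e w.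
  rewrite -!ball_normE/= => uv uw.
  rewrite -(subrKA u) (le_lt_trans (ler_normD _ _))// distrC.
  move: (ke); rewrite /= ltr_pdivlMr// mulr_natr mulr2n; apply: le_lt_trans.
  by rewrite lerD// ltW.
by split; [exact: tri q1y z1|exact: tri q2y z2].
Qed.

Lemma plane_compact_measurable (K : realType) (D : set (K * K)) :
  compact D -> measurable (D : set (measurableTypeR K * measurableTypeR K)).
Proof.
move=> cD; rewrite -[D]setCK; apply: measurableC; apply: plane_open_measurable.
apply: closed_openC; apply: compact_closed => //; exact: norm_hausdorff.
Qed.

Lemma plane_compact_finite_measure (K : realType) (D : set (K * K)) :
  compact D -> ((lebesgue_measure \x lebesgue_measure)%E D < +oo)%E.
Proof.
move=> cD; have [M [_ DM]] := compact_bounded cD.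
have {}DM y : D y -> `|y| <= M + 1 by move=> Dy; apply: DM Dy; rewrite ltrDl.
pose I := `[- (M + 1), M + 1]%classic : set (measurableTypeR K).
apply: (@le_lt_trans _ _ ((lebesgue_measure \x lebesgue_measure)%E (I `*` I))).
  rewrite le_measure ?inE//.
  - exact: plane_compact_measurable.
  - by apply: measurableX; exact: measurable_itv.
  - move=> y /DM; rewrite /I prod_normE/= => yM.
    split; rewrite /= in_itv/= -ler_norml (le_trans _ yM)//.
      by rewrite le_max lexx.
    by rewrite le_max lexx orbT.
rewrite product_measure1E; [|exact: measurable_itv..].
have I_fin : (lebesgue_measure I < +oo)%E.
  apply: (eq_ind_r (fun v => v < +oo)%E _
    (lebesgue_measure_itv `[- (M + 1), M + 1])) => /=.
  by case: ifP => _; rewrite ?ltry// -EFinB ltry.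
by rewrite lte_mul_pinfty// ge0_fin_numE.
Qed.

Lemma peval_continuous (K : realType) (p : mpoly 2 K) : continuous (peval p).
Proof.
rewrite /peval; under eq_fun do rewrite mevalE.
apply: (@continuous_big K _ +%R 0 xpredT); first exact: add_continuous.
move=> m _ y; apply: cvgM; first exact: cvg_cst.
apply: (@cvg_big K 'I_2 *%R 1 xpredT _ _ _ _ (fun i => (fun z : K * K =>
  (if i == ord0 then z.1 else z.2) ^+ m i))) => [|i _].
  exact: mul_continuous.
apply: (@continuous_comp _ _ _ (fun z : K * K => if i == ord0 then z.1 else z.2)
  (fun t : K => t ^+ m i)); last exact: exprn_continuous.
by case: (i == ord0); [exact: cvg_fst|exact: cvg_snd].
Qed.

Lemma measurable_peval (K : realType) (p : mpoly 2 K) :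
  measurable_fun setT
    (peval p : measurableTypeR K * measurableTypeR K -> measurableTypeR K).
Proof.
rewrite /peval; under eq_fun do rewrite mevalE.
apply: measurable_sum => m; apply: measurable_funM => //.
apply: measurable_prod => i _; apply: measurable_funX.
by case: eqP => _; [exact: measurable_fst|exact: measurable_snd].
Qed.

Lemma integrable_peval (K : realType) (D : set (K * K)) (p : mpoly 2 K) :
  compact D -> (lebesgue_measure \x lebesgue_measure)%E.-integrable
    (D : set (measurableTypeR K * measurableTypeR K)) (EFin \o peval p).
Proof.
move=> cD; apply: measurable_bounded_integrable.
- exact: plane_compact_measurable.
- exact: plane_compact_finite_measure.
- exact: measurable_funTS (measurable_peval _ _).
have : compact (peval p @` D).
  apply: continuous_compact => //; apply: continuous_subspaceT.
  exact: peval_continuous.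
move=> /compact_bounded[M [_ DM]].
exists M; split; rewrite ?num_real// => t Mt y Dy.
by apply: DM Mt _ _; exists y.
Qed.

(** * The extremal property of the Christoffel function *)

Lemma pevalM (K : realType) (p q : mpoly 2 K) y :
  peval (p * q) y = peval p y * peval q y.
Proof. exact: mevalM. Qed.

Lemma peval_suml (K : realType) (N : nat) (a : 'I_N -> K)
    (phi : 'I_N -> mpoly 2 K) y :
  peval (\sum_k a k *: phi k) y = \sum_k a k * peval (phi k) y.
Proof.
by rewrite /peval raddf_sum; apply: eq_bigr => k _; exact: mevalZ.
Qed.

(** The real integral is [fine] of an extended one, so linearity rests on integrability of each
    term, which compactness of [D] provides. *)
Lemma inner_suml (K : realType) (D : set (K * K)) (N : nat) (a : 'I_N -> K)
    (phi : 'I_N -> mpoly 2 K) (q : mpoly 2 K) : compact D ->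
  inner D (\sum_k a k *: phi k) q = \sum_k a k * inner D (phi k) q.
Proof.
move=> cD; have mD := plane_compact_measurable _ _ cD.
rewrite /inner.
transitivity (\int[(lebesgue_measure \x lebesgue_measure)%E]_(y in D)
    \sum_k a k * (peval (phi k) y * peval q y)).
  congr fine; apply: eq_integral => y _; congr EFin.
  by rewrite peval_suml mulr_suml; apply: eq_bigr => k _; rewrite mulrA.
have ipq k : (lebesgue_measure \x lebesgue_measure)%E.-integrable
    (D : set (measurableTypeR K * measurableTypeR K))
    (EFin \o (fun y => peval (phi k) y * peval q y)).
  under [_ \o _]eq_fun do rewrite -pevalM.
  exact: integrable_peval.
have iapq k : (lebesgue_measure \x lebesgue_measure)%E.-integrable
    (D : set (measurableTypeR K * measurableTypeR K))
    (fun y => (a k * (peval (phi k) y * peval q y))%:E).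
  by under eq_fun do rewrite EFinM; apply: integrableZl => //; exact: ipq.
rewrite /Rintegral.
under eq_integral do rewrite -sumEFin.
rewrite integral_sum//.
rewrite -sum_fine => [|k _]; last first.
  by apply: integrable_fin_num => //; exact: iapq.
by apply: eq_bigr => k _; exact: RintegralZl (ipq k).
Qed.

Lemma innerC (K : realType) (D : set (K * K)) (p q : mpoly 2 K) :
  inner D p q = inner D q p.
Proof.
by rewrite /inner; congr fine; apply: eq_integral => y _; rewrite mulrC.
Qed.

(** Cauchy-Schwarz for the coefficients of f and the values of the basis at x, obtained by expanding
    a sum of squares with the optimal parameter t. *)
Lemma christoffel_le_inner (K : realType) (n : nat) (D : set (K * K)) (N : nat)
    (phi : 'I_N -> mpoly 2 K) (x : K * K) (f : mpoly 2 K) :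
  compact D -> orthonormal_basis n D phi -> in_Pn n f -> 1 <= peval f x ->
  christoffel phi x <= inner D f f.
Proof.
move=> cD [_ ortho basis] fn f1.
have [a fE] := basis f fn.
have -> : inner D f f = \sum_k a k ^+ 2.
  rewrite {1}fE inner_suml//; apply: eq_bigr => k _.
  rewrite expr2; congr (_ * _).
  rewrite innerC fE inner_suml// (bigD1 k)//= ortho eqxx mulr1 big1 ?addr0//.
  by move=> j jk; rewrite ortho (negbTE jk) mulr0.
have Sfx : peval f x = \sum_k a k * peval (phi k) x by rewrite {1}fE peval_suml.
rewrite /christoffel; set B := \sum_k _ ^+ 2; set t := B^-1.
have t0 : 0 <= t by rewrite invr_ge0 sumr_ge0// => k _; exact: sqr_ge0.
(* This also covers B = 0, where the inverse is 0 by convention. *)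
have tB : t ^+ 2 * B = t.
  rewrite /t; have [->|B0] := eqVneq B 0; first by rewrite invr0 mulr0.
  by rewrite expr2 mulfVK.
have : 0 <= \sum_k (a k - t * peval (phi k) x) ^+ 2.
  by apply: sumr_ge0 => k _; exact: sqr_ge0.
have -> : \sum_k (a k - t * peval (phi k) x) ^+ 2 =
    \sum_k a k ^+ 2 - 2 * t * peval f x + t.
  transitivity (\sum_k a k ^+ 2 - 2 * t * peval f x + t ^+ 2 * B).
    rewrite Sfx /B !mulr_sumr -sumrB -big_split/=.
    by apply: eq_bigr => k _; ring.
  by rewrite tB.
have : t <= t * peval f x by rewrite ler_peMr.
lra.
Qed.

(** * Bivariate test polynomials built from affine forms *)

Lemma in_PnM (K : realType) (m n : nat) (p q : mpoly 2 K) :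
  in_Pn m p -> in_Pn n q -> in_Pn (m + n) (p * q).
Proof.
rewrite /in_Pn => pm qn.
have [->|p0] := eqVneq p 0; first by rewrite mul0r msize0.
have [->|q0] := eqVneq q 0; first by rewrite mulr0 msize0.
rewrite msizeM//; move: (leq_add pm qn); rewrite addSn addnS.
by case: (_ + _)%N.
Qed.

Lemma in_PnX (K : realType) (p : mpoly 2 K) (i : nat) :
  in_Pn 1 p -> in_Pn i (p ^+ i).
Proof.
move=> p1; elim: i => [|i IHi]; first by rewrite expr0 /in_Pn msize1.
by rewrite exprS -add1n in_PnM.
Qed.

Lemma in_Pn_horner (K : realType) (n : nat) (P : {poly K}) (A : mpoly 2 K) :
  (size P <= n.+1)%N -> in_Pn 1 A ->
  in_Pn n (\sum_(i < size P) P`_i *: A ^+ i).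
Proof.
move=> sP A1; rewrite /in_Pn (leq_trans (msize_sum _ _ _))//.
apply/bigmax_leqP => i _; rewrite (leq_trans (msizeZ_le _ _))//.
rewrite (leq_trans (in_PnX _ _ i A1))// ltnS.
by rewrite -ltnS (leq_trans (ltn_ord i)).
Qed.

Lemma peval_horner (K : realType) (P : {poly K}) (A : mpoly 2 K) (y : K * K) :
  peval (\sum_(i < size P) P`_i *: A ^+ i) y = P.[peval A y].
Proof.
rewrite horner_coef /peval raddf_sum; apply: eq_bigr => i _.
by rewrite /= mevalZ rmorphXn.
Qed.

Definition affine_mpoly (K : realType) (a b c : K) : mpoly 2 K :=
  a *: mpolyX K (mnm1 ord0) + b *: mpolyX K (mnm1 ord_max) + mpolyC 2 c.

Lemma in_Pn_affine (K : realType) (a b c : K) : in_Pn 1 (affine_mpoly K a b c).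
Proof.
rewrite /in_Pn /affine_mpoly (leq_trans (msizeD_le _ _))// geq_max.
rewrite msizeC (leq_trans (leq_b1 _))// andbT.
rewrite (leq_trans (msizeD_le _ _))// geq_max.
by rewrite !(leq_trans (msizeZ_le _ _))// msizeX mdeg1.
Qed.

Lemma peval_affine (K : realType) (a b c : K) (y : K * K) :
  peval (affine_mpoly K a b c) y = a * y.1 + b * y.2 + c.
Proof.
by rewrite /peval /affine_mpoly !mevalD !mevalZ !mevalXU mevalC.
Qed.

Lemma integral_sqr_indic (K : realType) (P : {poly K}) :
  (\int[lebesgue_measure]_t (\1_`[0%R, 1%R] t * P.[t] ^+ 2)%:E =
   \int[lebesgue_measure]_(t in `[0%R, 1%R]) (P.[t] ^+ 2)%:E)%E.
Proof.
rewrite [RHS]integral_mkcond; apply: eq_integral => t _.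
rewrite patchE indicE; case: ifP => _; first by rewrite mul1r.
by rewrite mul0r.
Qed.

(** Cutting both factors off outside [0, 1] changes nothing on [D]. The integrand is nonnegative, so
    the domain may be enlarged to the whole plane, where the integral factorises. *)
Lemma inner_affine_le (K : realType) (D : set (K * K))
    (a1 b1 c1 a2 b2 c2 : K) (P1 P2 : {poly K}) (I1 I2 : K) (f : mpoly 2 K) :
  compact D ->
  (forall y, D y -> 0 <= a1 * y.1 + b1 * y.2 + c1 <= 1) ->
  (forall y, D y -> 0 <= a2 * y.1 + b2 * y.2 + c2 <= 1) ->
  a1 * b2 - a2 * b1 != 0 ->
  (\int[lebesgue_measure]_(t in `[0%R, 1%R]) (P1.[t] ^+ 2)%:E <= I1%:E)%E ->
  (\int[lebesgue_measure]_(t in `[0%R, 1%R]) (P2.[t] ^+ 2)%:E <= I2%:E)%E ->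
  (forall y, peval f y =
    P1.[a1 * y.1 + b1 * y.2 + c1] * P2.[a2 * y.1 + b2 * y.2 + c2]) ->
  inner D f f <= I1 * I2 / `|a1 * b2 - a2 * b1|.
Proof.
move=> cD D1 D2 J0 int1 int2 fE.
have mD := plane_compact_measurable _ _ cD.
pose h (P : {poly K}) (t : K) : \bar K := (\1_`[0, 1] t * P.[t] ^+ 2)%:E.
have mh P : measurable_fun setT (h P).
  apply/measurable_EFinP; apply: measurable_funM.
    by apply: measurable_indic; exact: measurable_itv.
  apply: measurable_funX; apply: continuous_measurable_fun.
  exact: continuous_horner.
have h0 P t : (0 <= h P t)%E by rewrite lee_fin mulr_ge0 ?sqr_ge0.
have iD := integrable_peval _ _ (f * f) cD.
have mf : measurable_fun setT ((EFin \o peval (f * f)) \_ D).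
  apply: (measurable_restrictT _ mD).1; exact: measurable_int iD.
have -> : inner D f f = fine
    (\int[(lebesgue_measure \x lebesgue_measure)%E]_(y in D)
    (EFin \o peval (f * f)%R) y)%E.
  by congr fine; apply: eq_integral => y _; rewrite /= pevalM.
rewrite -lee_fin fineK; last exact: integrable_fin_num.
apply: (@le_trans _ _ (\int[(lebesgue_measure \x lebesgue_measure)%E]_y
   (h P1 (a1 * y.1 + b1 * y.2 + c1)%R * h P2 (a2 * y.1 + b2 * y.2 + c2)%R))%E).
  rewrite integral_mkcond; apply: ge0_le_integral => //.
  - move=> y _; rewrite patchE; case: ifP => // _.
    by rewrite lee_fin pevalM -expr2 sqr_ge0.
  - by apply: emeasurable_funM; apply: measurableT_comp => //;
      exact: measurable_affine2.
  - move=> y _; rewrite patchE; case: ifPn => [/set_mem Dy|_]; last first.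
      exact: mule_ge0.
    rewrite /h !indicE !mem_set//=; [|by rewrite in_itv/= D2|
      by rewrite in_itv/= D1].
    by rewrite !mul1r -EFinM pevalM fE -expr2 exprMn.
rewrite ge0_integral_affine2// [X in (_ <= X%:E)%E]mulrC EFinM.
rewrite lee_pmul2l ?lte_fin ?invr_gt0 ?normr_gt0//.
rewrite EFinM !integral_sqr_indic; apply: lee_pmul => //.
  by apply: integral_ge0 => t _; rewrite lee_fin sqr_ge0.
by apply: integral_ge0 => t _; rewrite lee_fin sqr_ge0.
Qed.

Lemma christoffel_le_affine (K : realType) (kappa : K) : 0 < kappa ->
  exists C : K, 0 < C /\ forall (D : set (K * K)) (x : K * K) (n N : nat)
      (phi : 'I_N -> mpoly 2 K) (a1 b1 c1 a2 b2 c2 : K),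
    compact D -> D x -> (0 < n)%N -> orthonormal_basis n D phi ->
    (forall y, D y -> 0 <= a1 * y.1 + b1 * y.2 + c1 <= 1) ->
    (forall y, D y -> 0 <= a2 * y.1 + b2 * y.2 + c2 <= 1) ->
    a1 * b2 - a2 * b1 != 0 ->
    kappa * n%:R ^- 2 <= a1 * x.1 + b1 * x.2 + c1 ->
    kappa * n%:R ^- 2 <= a2 * x.1 + b2 * x.2 + c2 ->
    christoffel phi x <= C * n%:R ^- 2 *
      (Num.sqrt ((a1 * x.1 + b1 * x.2 + c1) * (a2 * x.1 + b2 * x.2 + c2))
        / `|a1 * b2 - a2 * b1|).
Proof.
move=> kappa0; have [C [C0 HC]] := univariate_christoffel_le K kappa kappa0.
exists (C ^+ 2); split; first exact: exprn_gt0.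
move=> D x n N phi a1 b1 c1 a2 b2 c2 cD Dx n0 ortho D1 D2 J0 hd1 hd2.
have /andP[d1ge0 d1le1] := D1 _ Dx; have /andP[_ d2le1] := D2 _ Dx.
set d1 := _ + c1 in hd1 d1ge0 d1le1 *; set d2 := _ + c2 in hd2 d2le1 *.
have [P1 [sP1 P11 int1]] := HC n d1 n0 hd1 d1le1.
have [P2 [sP2 P21 int2]] := HC n d2 n0 hd2 d2le1.
pose f := (\sum_(i < size P1) P1`_i *: (affine_mpoly K a1 b1 c1) ^+ i) *
          (\sum_(i < size P2) P2`_i *: (affine_mpoly K a2 b2 c2) ^+ i).
have fE y : peval f y =
    P1.[a1 * y.1 + b1 * y.2 + c1] * P2.[a2 * y.1 + b2 * y.2 + c2].
  by rewrite pevalM !peval_horner !peval_affine.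
have fn : in_Pn n f.
  have: in_Pn (n./2 + n./2) f by rewrite in_PnM ?in_Pn_horner ?in_Pn_affine.
  by rewrite /in_Pn => /leq_trans; apply; lia.
have f1 : 1 <= peval f x by rewrite fE mulr_ege1.
apply: (le_trans (christoffel_le_inner _ _ _ _ _ _ _ cD ortho fn f1)).
apply: (le_trans (inner_affine_le _ _ _ _ _ _ _ _ _ _ _ _ _
  cD D1 D2 J0 int1 int2 fE)).
rewrite sqrtrM// le_eqVlt; apply/predU1P; left.
rewrite -exprVn; field.
by rewrite pnatr_eq0 -lt0n n0 andbT normr_eq0.
Qed.

(** * Euclidean geometry of the plane and separating lines *)

Lemma dotp_eq1 (K : realType) (w : K * K) : enorm w = 1 -> dotp w w = 1.
Proof.
move=> w1; rewrite -[LHS]sqr_sqrtr; last by rewrite addr_ge0// -expr2 sqr_ge0.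
by rewrite -/(enorm w) w1 expr1n.
Qed.

Lemma enormN (K : realType) (w : K * K) : enorm (- w) = enorm w.
Proof. by rewrite /enorm /dotp/= !mulrNN. Qed.

Lemma dotp_le_enorm (K : realType) (w y : K * K) :
  enorm w = 1 -> dotp w y <= enorm y.
Proof.
move=> /dotp_eq1 w1; apply: (le_trans (ler_norm _)); rewrite -sqrtr_sqr.
apply: ler_wsqrtr; rewrite -[dotp y y]mul1r -w1 -subr_ge0.
rewrite (_ : _ - _ = (w.1 * y.2 - w.2 * y.1) ^+ 2) ?sqr_ge0//.
by rewrite /dotp; ring.
Qed.

Lemma dotp_sub_disc_le (K : realType) (a w y z : K * K) (R : K) :
  enorm w = 1 -> disc a R y -> disc a R z -> dotp w (y - z) <= 2 * R.
Proof.
move=> w1 ya za.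
have -> : dotp w (y - z) = dotp w (y - a) + dotp (- w) (z - a).
  by rewrite /dotp/=; ring.
have := le_trans (dotp_le_enorm _ w (y - a) w1) ya.
have := le_trans (dotp_le_enorm _ (- w) (z - a) (etrans (enormN _ w) w1)) za.
lra.
Qed.

Lemma disc_center (K : realType) (a : K * K) (r : K) : 0 <= r -> disc a r a.
Proof.
by move=> r0; rewrite /disc/= subrr /enorm /dotp/= mulr0 addr0 sqrtr0.
Qed.

Lemma disc_subr (K : realType) (a w : K * K) (r : K) :
  0 <= r -> enorm w = 1 -> disc a r (a - r *: w).
Proof.
move=> r0 w1; rewrite /disc/= addrAC subrr add0r enormN /enorm.
have -> : dotp (r *: w) (r *: w) = r ^+ 2 * dotp w w.
  by rewrite /dotp/= /GRing.scale/=; ring.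
by rewrite dotp_eq1// mulr1 sqrtr_sqr ger0_norm.
Qed.

Lemma dotp_sub_continuous (K : realType) (z : K * K) :
  continuous (fun y : K * K => dotp (y - z) (y - z)).
Proof.
have cf : continuous (fun y : K * K => y.1 - z.1).
  by move=> y; apply: cvgB; [exact: cvg_fst|exact: cvg_cst].
have cs : continuous (fun y : K * K => y.2 - z.2).
  by move=> y; apply: cvgB; [exact: cvg_snd|exact: cvg_cst].
by move=> y; apply: cvgD; apply: cvgM;
  [exact: cf|exact: cf|exact: cs|exact: cs].
Qed.

(* [w] is the direction from [z] to its nearest point in [D]. *)
Lemma convex_separation (K : realType) (D : set (K * K)) (z : K * K) :
  convex_set D -> compact D -> D !=set0 -> ~ D z ->
  exists w, enorm w = 1 /\ forall y, D y -> 0 <= dotp w (y - z).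
Proof.
move=> convD cD D0 Dz.
have [p pD pmin] : exists2 p, p \in D & forall y, y \in D ->
    dotp (p - z) (p - z) <= dotp (y - z) (y - z).
  apply: (@compact_EVT_min (K * K)%type K
    (fun y => dotp (y - z) (y - z))) => //.
  by apply: continuous_subspaceT => y; exact: dotp_sub_continuous.
pose q := p - z; set M := dotp q q in pmin.
have q0 : 0 < M.
  rewrite lt_def addr_ge0 -?expr2 ?sqr_ge0// andbT.
  apply/eqP => /eqP; rewrite /M /dotp -!expr2 paddr_eq0 ?sqr_ge0// !sqrf_eq0.
  rewrite !subr_eq0 => /andP[/eqP p1 /eqP p2]; apply: Dz.
  by move: pD; rewrite inE [p]surjective_pairing p1 p2 -surjective_pairing.
have obtuse y : D y -> 0 <= dotp q (y - p).
  move=> Dy; rewrite leNgt; apply/negP => s0.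
  set s := dotp q (y - p) in s0; pose V := dotp (y - p) (y - p).
  have V0 : 0 <= V by rewrite addr_ge0// -expr2 sqr_ge0.
  (* If the angle at p were acute, a step t towards y would change the squared distance to z by t (2
     s + t V). This t is at most 1 and satisfies t V <= - s, so the change is negative. *)
  pose t := - s / (- s + V).
  have sV : 0 < - s + V by rewrite ltr_pwDl// oppr_gt0.
  have t0 : 0 < t by rewrite divr_gt0// oppr_gt0.
  have t1 : t <= 1 by rewrite ler_pdivrMr// mul1r lerDl.
  have Dc : t *: y + (1 - t) *: p \in D :=
    convD y p (Itv01 (ltW t0) t1) (mem_set Dy) pD.
  have := pmin _ Dc; rewrite leNgt => /negP; apply.
  have -> : dotp (t *: y + (1 - t) *: p - z) (t *: y + (1 - t) *: p - z) =
      M + t * (2 * s + t * V).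
    by rewrite /M /s /V /dotp/= /q/= /GRing.scale/=; ring.
  rewrite gtrDl pmulr_rlt0//.
  have : t * V <= - s.
    rewrite mulrAC ler_pdivrMr// ler_wpM2l ?oppr_ge0 ?(ltW s0)//.
    by rewrite lerDr oppr_ge0 ltW.
  lra.
have N0 : 0 < enorm q by rewrite sqrtr_gt0.
exists ((enorm q)^-1 *: q); split.
  rewrite /enorm (_ : dotp _ _ = (enorm q)^-1 ^+ 2 * dotp q q).
    by rewrite /enorm -/M exprVn sqr_sqrtr ?(ltW q0)// mulVf ?gt_eqF// sqrtr1.
  by rewrite /dotp/= /GRing.scale/=; ring.
move=> y Dy.
have -> : dotp ((enorm q)^-1 *: q) (y - z) =
    (enorm q)^-1 * (dotp q (y - p) + M).
  by rewrite /M /dotp/= /q /GRing.scale/=; ring.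
by rewrite mulr_ge0 ?invr_ge0 ?(ltW N0)// addr_ge0 ?(ltW q0)// obtuse.
Qed.

(** Used for the positivity of the half-chords. Balls are those of the sup norm, and the coordinates
    of a unit vector are at most 1 in absolute value. *)
Lemma interior_ray (K : realType) (D : set (K * K)) (x e : K * K) :
  D° x -> enorm e = 1 -> exists2 t, 0 < t & D (x + t *: e).
Proof.
move=> /nbhs_ballP[eps /= eps0 xD] e1.
exists (eps / 2); first by rewrite divr_gt0.
have e2 := dotp_eq1 _ _ e1; rewrite /dotp -!expr2 in e2.
have e1le (c : K) : c ^+ 2 <= 1 -> ball (0 : K) eps (eps / 2 * c).
  move=> c1; rewrite -ball_normE/= sub0r normrN normrM gtr0_norm ?divr_gt0//.
  have : `|c| <= 1 by rewrite -(@expr_le1 _ 2)// real_normK ?num_real.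
  have := normr_ge0 c; nra.
apply: xD; split => /=.
  have := e1le e.1; rewrite -!ball_normE/= sub0r opprD addNKr; apply.
  have := sqr_ge0 e.2; lra.
have := e1le e.2; rewrite -!ball_normE/= sub0r opprD addNKr; apply.
have := sqr_ge0 e.1; lra.
Qed.

(** The point at parameter 2 l lies outside [D], yet its distance to x is comparable to l. The upper
    bound adds a width of at most 2 R, measured from the chord end, to l <= 2 R. *)
Lemma ray_separation (K : realType) (D : set (K * K)) (a x e : K * K)
    (R l : K) :
  convex_set D -> compact D -> D `<=` disc a R -> D x -> enorm e = 1 ->
  0 < l -> is_max [set t | D (x + t *: e)] l ->
  exists w, enorm w = 1 /\
    forall y, D y -> 0 <= dotp w (y - (x + (2 * l) *: e)) <= 4 * R.
Proof.
move=> convD cD DR Dx e1 l0 [Dl lmax].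
have [|w [w1 Dw]] := convex_separation _ D (x + (2 * l) *: e) convD cD
  (ex_intro _ x Dx).
  by move=> /lmax/=; rewrite leNgt => /negP; apply; lra.
exists w; split=> // y Dy; rewrite Dw//=.
have lR : l <= 2 * R.
  have := dotp_sub_disc_le _ _ _ _ _ _ e1 (DR _ Dl) (DR _ Dx).
  have -> : dotp e (x + l *: e - x) = l * dotp e e.
    by rewrite /dotp/= /GRing.scale/=; ring.
  by rewrite dotp_eq1// mulr1.
have yR := dotp_sub_disc_le _ _ _ _ _ _ w1 (DR _ Dy) (DR _ Dl).
have we : dotp (- w) e <= 1 by rewrite -e1 dotp_le_enorm// enormN.
rewrite (_ : dotp w _ =
  dotp w (y - (x + l *: e)) + l * dotp (- w) e); last first.
  by rewrite /dotp/= /GRing.scale/=; ring.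
nra.
Qed.

(** * The bound obtained from two separating lines *)

Lemma christoffel_le_normals (K : realType) (r R sigma : K) :
  0 < r -> 0 < R -> 0 < sigma ->
  exists C : K, 0 < C /\
    forall (D : set (K * K)) (a x u : K * K) (delta t0 : K) (n N : nat)
      (phi : 'I_N -> mpoly 2 K) (w1 z1 w2 z2 : K * K),
    compact D -> D `<=` disc a R -> D x -> enorm u = 1 ->
    t0 < 0 -> disc (x + t0 *: u) r `<=` D -> D (x + delta *: u) ->
    (0 < n)%N -> sigma * n%:R ^- 2 <= delta -> orthonormal_basis n D phi ->
    enorm w1 = 1 -> (forall y, D y -> 0 <= dotp w1 (y - z1) <= 4 * R) ->
    enorm w2 = 1 -> (forall y, D y -> 0 <= dotp w2 (y - z2) <= 4 * R) ->
    w1.1 * w2.2 - w2.1 * w1.2 != 0 ->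
    christoffel phi x <= C * n%:R ^- 2 *
      (Num.sqrt (dotp w1 (x - z1) * dotp w2 (x - z2)) /
       `|w1.1 * w2.2 - w2.1 * w1.2|).
Proof.
move=> r0 R0 sigma0.
(* The distance A from x to either line will satisfy r delta <= 2 R A; dividing A by the normalising
   factor 4 R gives 8 R^2. *)
have kappa0 : 0 < r * sigma / (8 * R ^+ 2).
  by rewrite divr_gt0 ?mulr_gt0// exprn_gt0.
have [C [C0 HC]] := christoffel_le_affine K _ kappa0.
(* Scaling both forms by s = 1 / (4 R) multiplies the square root by s and the Jacobian by s^2, so
   the quotient gains 4 R. *)
exists (C * (4 * R)); split; first by rewrite !mulr_gt0.
move=> D a x u delta t0 n N phi w1 z1 w2 z2 cD DR Dx u1 t00 Dt0 Ddelta n0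
  hdelta ortho w11 Dw1 w21 Dw2 J0.
have R4 : 0 < 4 * R by rewrite mulr_gt0.
have delta0 : 0 < delta.
  by rewrite (lt_le_trans _ hdelta)// divr_gt0// exprn_gt0// ltr0n.
(* Interpolate between [x + delta u] and the point of the disc behind [x] that
   is closest to the line. *)
have dlow w z : enorm w = 1 ->
    (forall y, D y -> 0 <= dotp w (y - z) <= 4 * R) ->
    r * sigma / (8 * R ^+ 2) * n%:R ^- 2 <= dotp w (x - z) / (4 * R).
  move=> w_1 Dw.
  have ww := dotp_eq1 _ _ w_1.
  have /Dw/andP[+ _] := Ddelta.
  have -> : dotp w (x + delta *: u - z) = dotp w (x - z) + delta * dotp w u.
    by rewrite /dotp/= /GRing.scale/=; ring.
  have /Dt0/Dw/andP[+ _] := disc_subr _ (x + t0 *: u) w r (ltW r0) w_1.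
  have -> : dotp w (x + t0 *: u - r *: w - z) =
      dotp w (x - z) + t0 * dotp w u - r * dotp w w.
    by rewrite /dotp/= /GRing.scale/=; ring.
  have Dxt0 := Dt0 _ (disc_center _ (x + t0 *: u) r (ltW r0)).
  have := dotp_sub_disc_le _ _ _ _ _ _ u1 (DR _ Ddelta) (DR _ Dxt0).
  have -> : dotp u (x + delta *: u - (x + t0 *: u)) = (delta - t0) * dotp u u.
    by rewrite /dotp/= /GRing.scale/=; ring.
  rewrite (dotp_eq1 _ _ u1) ww !mulr1 => tR.
  set A := dotp w (x - z); set B := dotp w u => h1 h2.
  (* Add delta times [h1] to - t0 times [h2]: the terms in B cancel. *)
  have h3 : r * delta <= (delta - t0) * A by nra.
  have A0 : 0 <= A by have /andP[] := Dw _ Dx.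
  have h4 : r * delta <= 2 * R * A by nra.
  rewrite ler_pdivlMr// [leLHS](_ : _ = r * (sigma * n%:R ^- 2) / (2 * R)).
    rewrite ler_pdivrMr ?mulr_gt0// [leRHS]mulrC (le_trans _ h4)//.
    by rewrite ler_wpM2l// ltW.
  by field; rewrite gt_eqF// pnatr_eq0 -lt0n n0.
pose s := (4 * R)^-1.
have s0 : 0 < s by rewrite invr_gt0.
have dotpE w z y : s * w.1 * y.1 + s * w.2 * y.2 - s * dotp w z =
    dotp w (y - z) / (4 * R).
  by rewrite -/s /dotp/=; ring.
have scaled w z : (forall y, D y -> 0 <= dotp w (y - z) <= 4 * R) ->
    forall y, D y -> 0 <= s * w.1 * y.1 + s * w.2 * y.2 - s * dotp w z <= 1.
  move=> Dw y /Dw/andP[h1 h2].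
  by rewrite dotpE divr_ge0 ?(ltW R4)//= ler_pdivrMr// mul1r.
have JE : s * w1.1 * (s * w2.2) - s * w2.1 * (s * w1.2) =
    s ^+ 2 * (w1.1 * w2.2 - w2.1 * w1.2) by ring.
have := HC D x n N phi _ _ _ _ _ _ cD Dx n0 ortho
  (scaled _ _ Dw1) (scaled _ _ Dw2).
rewrite !dotpE JE => /(_ _ (dlow _ _ w11 Dw1) (dlow _ _ w21 Dw2)).
have sJ0 : s ^+ 2 * (w1.1 * w2.2 - w2.1 * w1.2) != 0.
  by rewrite mulf_neq0// expf_neq0// gt_eqF.
move=> /(_ sJ0) /le_trans; apply.
rewrite -/s (_ : dotp w1 _ * _ * _ =
  s ^+ 2 * (dotp w1 (x - z1) * dotp w2 (x - z2))); last by ring.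
rewrite sqrtrM ?sqr_ge0// sqrtr_sqr normrM.
rewrite (gtr0_norm s0) (gtr0_norm (exprn_gt0 2 s0)).
rewrite le_eqVlt; apply/predU1P; left.
rewrite /s; field.
by rewrite normr_eq0 J0 pnatr_eq0 -lt0n n0 gt_eqF.
Qed.

(** * Choice of the lines according to delta and the two half-chords *)

Theorem theorem1p1 (K : realType) (r R sigma : K)
    (hr : 0 < r) (hR : 0 < R) (hsigma : 0 < sigma) :
  exists c : K, 0 < c /\
    forall (D : set (K * K)) (x u v : K * K) (delta l1 l2 : K) (n : nat),
      convex_body D ->
      (exists a : K * K, D `<=` disc a R) ->
      (D `\` boundary D) x ->
      enorm u = 1 ->
      (exists t0 : K, t0 < 0 /\ disc (x + t0 *: u) r `<=` D) ->
      enorm v = 1 ->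
      dotp u v = 0 ->
      is_max [set t : K | D (x + t *: u)] delta ->
      is_max [set t : K | D (x - t *: v)] l1 ->
      is_max [set t : K | D (x + t *: v)] l2 ->
      (0 < n)%N ->
      sigma * n%:R ^- 2 <= delta ->
      forall (N : nat) (phi : 'I_N -> mpoly.mpoly 2 K),
        orthonormal_basis n D phi ->
        christoffel phi x <= c * n%:R ^- 2 * Num.sqrt (Num.min (l1 * l2) delta).
Proof.
have [C [C0 HC]] := christoffel_le_normals K r R sigma hr hR hsigma.
have R4 : 0 < 4 * R by rewrite mulr_gt0.
have [c1_ge0 c2_ge0 c3_ge0] : [/\ 0 <= Num.sqrt (4 * R),
    0 <= Num.sqrt (4 * R * (4 / r)) & 0 < 4 * R / r].
  by rewrite !sqrtr_ge0 divr_gt0.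
(* The three summands serve, in order, the bound by delta, a chord with a half longer than r / 4,
   and a chord with both halves at most r / 4. *)
exists (C * (Num.sqrt (4 * R) + Num.sqrt (4 * R * (4 / r)) + 4 * R / r)).
split; first by rewrite mulr_gt0// ltr_wpDl// addr_ge0.
move=> D x u v delta l1 l2 n [convD cD _] [a DR] [Dx xbd] u1 [t0 [t00 Dt0]] v1
  uv hdelta hl1 hl2 n0 sdelta N phi ortho.
have xD : D° x.
  apply: contrapT => nx; apply: xbd; split=> //; exact: subset_closure.
have nv1 : enorm (- v) = 1 by rewrite enormN.
have {}hl1 : is_max [set t | D (x + t *: - v)] l1.
  by case: hl1 => h1 h2; split=> [|t]; rewrite /= scalerN//; apply: h2.
have n2 : 0 < n%:R ^- 2 :> K by rewrite invr_gt0 exprn_gt0// ltr0n.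
have delta0 : 0 < delta by rewrite (lt_le_trans _ sdelta)// mulr_gt0.
have max_gt0 e l : enorm e = 1 -> is_max [set t | D (x + t *: e)] l -> 0 < l.
  move=> e1 [_ lmax]; have [t t_gt0 Dt] := interior_ray _ _ _ _ xD e1.
  exact: lt_le_trans t_gt0 (lmax _ Dt).
have l1_gt0 := max_gt0 _ _ nv1 hl1; have l2_gt0 := max_gt0 _ _ v1 hl2.
have Ddelta : D (x + delta *: u) by case: hdelta.
have {}HC := HC D a x u delta t0 n N phi _ _ _ _ cD DR Dx u1 t00 Dt0 Ddelta n0
  sdelta ortho.
have bound c : 0 <= c -> forall m,
    christoffel phi x <= C * n%:R ^- 2 * (c * Num.sqrt m) ->
    c <= Num.sqrt (4 * R) + Num.sqrt (4 * R * (4 / r)) + 4 * R / r ->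
    christoffel phi x <= C * (Num.sqrt (4 * R) + Num.sqrt (4 * R * (4 / r)) +
      4 * R / r) * n%:R ^- 2 * Num.sqrt m.
  move=> c_ge0 m /le_trans h cle; apply: h.
  rewrite mulrA ler_wpM2r ?sqrtr_ge0// mulrAC ler_wpM2r ?(ltW n2)//.
  by rewrite ler_wpM2l// ltW.
have one_line e l : enorm e = 1 -> is_max [set t | D (x + t *: e)] l ->
    christoffel phi x <= C * n%:R ^- 2 * Num.sqrt (4 * R * l).
  move=> e1 hl; have l_gt0 := max_gt0 _ _ e1 hl.
  have [w [w1 Dw]] := ray_separation K D a x e R l convD cD DR Dx e1 l_gt0 hl.
  (* The second form only has to be harmless: its normal is [w] turned by a right angle, so the
     Jacobian is 1, and the offset 2 R keeps it within [0, 4 R] on [D] with value 2 R at x. *)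
  pose w' : K * K := (- w.2, w.1).
  have w'1 : enorm w' = 1.
    by rewrite -w1 /enorm /dotp/= mulrNN addrC.
  pose z := x - (2 * R) *: w'.
  have ww := dotp_eq1 _ _ w1; have w'w' := dotp_eq1 _ _ w'1.
  have zE y : dotp w' (y - z) = dotp w' (y - x) + 2 * R.
    transitivity (dotp w' (y - x) + 2 * R * dotp w' w').
      by rewrite /z /dotp /= /GRing.scale /=; ring.
    by rewrite w'w' mulr1.
  have Dw' y : D y -> 0 <= dotp w' (y - z) <= 4 * R.
    move=> Dy; rewrite zE.
    have := dotp_sub_disc_le _ _ _ _ _ _ w'1 (DR _ Dy) (DR _ Dx).
    have := dotp_sub_disc_le _ _ _ _ _ _ w'1 (DR _ Dx) (DR _ Dy).
    rewrite (_ : dotp w' (x - y) = - dotp w' (y - x)).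
      lra.
    by rewrite /dotp/=; ring.
  have JE : w.1 * w'.2 - w'.1 * w.2 = 1.
    by rewrite -ww /dotp /w'/=; ring.
  have := HC w _ w' z w1 Dw w'1 Dw'.
  rewrite JE oner_neq0 => /(_ isT) /le_trans; apply.
  rewrite ler_wpM2l ?(ltW (mulr_gt0 C0 n2))// normr1 divr1 ler_wsqrtr//.
  rewrite zE subrr (_ : dotp w' 0 = 0); last by rewrite /dotp/= !mulr0 addr0.
  rewrite add0r (_ : 4 * R * l = 2 * l * (2 * R)); last by ring.
  rewrite ler_wpM2r ?mulr_ge0 ?(ltW hR)//.
  rewrite (_ : dotp w _ = 2 * l * dotp (- w) e).
    rewrite ler_piMr ?mulr_ge0 ?(ltW l_gt0)//.
    by rewrite -e1 dotp_le_enorm// enormN.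
  by rewrite /dotp/= /GRing.scale/=; ring.
have [l12|_] := leP (l1 * l2) delta; last first.
  apply: (bound (Num.sqrt (4 * R))); rewrite ?sqrtr_ge0//.
    by rewrite -sqrtrM ?(ltW R4)//; exact: one_line u1 hdelta.
  by rewrite -addrA lerDl addr_ge0// ltW.
(* For l' > r / 4 one has l <= (4 / r) l l', so a single line at the other end of the chord
   suffices. *)
have long_chord e l l' : enorm e = 1 -> is_max [set t | D (x + t *: e)] l ->
    r / 4 < l' -> l * l' = l1 * l2 -> christoffel phi x <=
      C * n%:R ^- 2 * (Num.sqrt (4 * R * (4 / r)) * Num.sqrt (l1 * l2)).
  move=> e1 hl rl' <-; have l_gt0 := max_gt0 _ _ e1 hl.
  apply: (le_trans (one_line _ _ e1 hl)).
  rewrite ler_wpM2l ?(ltW (mulr_gt0 C0 n2))//.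
  rewrite -sqrtrM; last by rewrite mulr_ge0 ?(ltW R4)// divr_ge0// ltW.
  apply: ler_wsqrtr; rewrite -[4 * R * _ * _]mulrA ler_wpM2l ?(ltW R4)//.
  rewrite mulrCA ler_peMr ?(ltW l_gt0)//.
  rewrite mulrAC ler_pdivlMr// mul1r mulrC -ler_pdivrMr//; exact: ltW.
have [l1r|l1r] := ltP (r / 4) l1.
  apply: (bound (Num.sqrt (4 * R * (4 / r)))) => //.
    by apply: (long_chord v l2 l1); rewrite // mulrC.
  by rewrite -addrA addrCA lerDl addr_ge0// ltW.
have [l2r|l2r] := ltP (r / 4) l2.
  apply: (bound (Num.sqrt (4 * R * (4 / r)))) => //.
    exact: (long_chord (- v) l1 l2).
  by rewrite -addrA addrCA lerDl addr_ge0// ltW.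
apply: (bound (4 * R / r)); [exact: ltW| |by rewrite lerDr addr_ge0].
have [w1 [w11 Dw1]] :=
  ray_separation K D a x _ R _ convD cD DR Dx nv1 l1_gt0 hl1.
have [w2 [w21 Dw2]] :=
  ray_separation K D a x _ R _ convD cD DR Dx v1 l2_gt0 hl2.
have Dxt0 := Dt0 _ (disc_center _ (x + t0 *: u) r (ltW hr)).
have t0R : - t0 <= 2 * R.
  have := dotp_sub_disc_le _ _ _ _ _ _ u1 (DR _ Dx) (DR _ Dxt0).
  have -> : dotp u (x - (x + t0 *: u)) = - t0 * dotp u u.
    by rewrite /dotp/= /GRing.scale/=; ring.
  by rewrite (dotp_eq1 _ _ u1) mulr1.
(* The disc of radius [r] lies on the inner side of both lines while the lines
   pass within [r / 2] of [x]; hence both inner normals have a component along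
   [- u] bounded below. *)
have tilt w e l : enorm w = 1 -> enorm e = 1 -> 0 < l -> l <= r / 4 ->
    (forall y, D y -> 0 <= dotp w (y - (x + (2 * l) *: e)) <= 4 * R) ->
    0 < - dotp w e /\ r / (4 * R) <= - dotp w u.
  move=> w_1 e1 l_gt0 lr Dw.
  have ww := dotp_eq1 _ _ w_1.
  have we : dotp (- w) e <= 1 by rewrite -e1 dotp_le_enorm// enormN.
  have weE : dotp (- w) e = - dotp w e by rewrite /dotp/=; ring.
  rewrite weE in we.
  have /Dt0/Dw/andP[+ _] := disc_subr _ (x + t0 *: u) w r (ltW hr) w_1.
  have -> : dotp w (x + t0 *: u - r *: w - (x + (2 * l) *: e)) =
      2 * l * (- dotp w e) + t0 * dotp w u - r * dotp w w.
    by rewrite /dotp/= /GRing.scale/=; ring.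
  rewrite ww mulr1 => h.
  have h1 : 2 * l * (- dotp w e) <= r / 2 by nra.
  (* Half of r is used up by the offset 2 l <= r / 2; the other half, divided by - t0 <= 2 R, is the
     tilt r / (4 R). *)
  have h2 : r / 2 <= (- t0) * (- dotp w u) by lra.
  have tilted : r / (4 * R) <= - dotp w u.
    have wu0 : 0 < - dotp w u.
      have h3 : 0 < - t0 * - dotp w u by lra.
      by move: h3; rewrite pmulr_rgt0// oppr_gt0.
    by rewrite ler_pdivrMr//; nra.
  split=> //.
  (* The point x + delta u is also on the inner side, although moving along u brings it closer to
     the line; hence the line cannot pass through x, and the component along e has a strict sign. *)
  have /Dw/andP[+ _] := Ddelta.
  have -> : dotp w (x + delta *: u - (x + (2 * l) *: e)) =
      2 * l * (- dotp w e) - delta * (- dotp w u).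
    by rewrite /dotp/= /GRing.scale/=; ring.
  rewrite subr_ge0 => h3; rewrite -(pmulr_rgt0 _ (mulr_gt0 (ltr0Sn K 1) l_gt0)).
  by rewrite (lt_le_trans _ h3)// mulr_gt0// (lt_le_trans _ tilted)// divr_gt0.
have [p0 p'] := tilt _ _ _ w11 nv1 l1_gt0 l1r Dw1.
have [q0 q'] := tilt _ _ _ w21 v1 l2_gt0 l2r Dw2.
set J := w1.1 * w2.2 - w2.1 * w1.2.
pose p := dotp w1 v; pose q := - dotp w2 v.
have pE : - dotp w1 (- v) = p by rewrite /p /dotp/=; ring.
rewrite pE in p0; rewrite -/q in q0.
(* This is the determinant in the orthonormal frame u, v. The components along v have opposite signs
   and those along u the same sign, so the two products add up instead of cancelling. *)
have JE : `|J| = p * (- dotp w2 u) + q * (- dotp w1 u).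
  have uv1 : `|u.1 * v.2 - u.2 * v.1| = 1.
    apply/eqP; rewrite -(@eqrXn2 _ 2)// real_normK ?num_real// expr1n.
    rewrite (_ : _ ^+ 2 = dotp u u * dotp v v - dotp u v ^+ 2).
      by rewrite !dotp_eq1// uv expr0n mulr1 subr0.
    by rewrite /dotp; ring.
  rewrite -[LHS]mulr1 -uv1 -normrM -[RHS]ger0_norm.
    by congr `|_|; rewrite /J /p /q /dotp; ring.
  have tilt0 : 0 <= r / (4 * R) by rewrite divr_ge0 ?(ltW hr) ?(ltW R4).
  by rewrite addr_ge0// mulr_ge0 ?(ltW p0) ?(ltW q0)// (le_trans tilt0).
have Jge : r / (4 * R) * (p + q) <= `|J|.
  rewrite JE mulrDr [_ * p]mulrC [_ * q]mulrC.
  by rewrite lerD// ler_wpM2l ?(ltW p0) ?(ltW q0).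
have J_gt0 : 0 < `|J|.
  by rewrite (lt_le_trans _ Jge)// mulr_gt0 ?divr_gt0// addr_gt0.
have := HC w1 _ w2 _ w11 Dw1 w21 Dw2.
rewrite -/J -normr_gt0 => /(_ J_gt0) /le_trans; apply.
rewrite ler_wpM2l ?(ltW (mulr_gt0 C0 n2))// ler_pdivrMr//.
rewrite (_ : dotp w1 _ * _ = l1 * l2 * (4 * (p * q))); last first.
  by rewrite /p /q /dotp/= /GRing.scale/=; ring.
rewrite sqrtrM ?mulr_ge0 ?(ltW l1_gt0) ?(ltW l2_gt0)// mulrAC [leRHS]mulrC.
(* It remains to compare 2 sqrt(p q) with the Jacobian, through the arithmetic-geometric mean
   inequality and [Jge]. *)
rewrite ler_wpM2l ?sqrtr_ge0// (le_trans (y := p + q))//.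
  have -> : p + q = Num.sqrt ((p + q) ^+ 2).
    by rewrite sqrtr_sqr ger0_norm// addr_ge0// ltW.
  rewrite ler_wsqrtr// -subr_ge0 (_ : _ - _ = (p - q) ^+ 2) ?sqr_ge0//; ring.
by rewrite mulrC -ler_pdivrMr// mulrC invf_div.
Qed.
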